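(* Let $\mathbf U$ and the scalar multiplication $\cdot\colon\mathbb R_{\ge0}\times\mathbf U\to\mathbf U$ be as defined in the context. The map $\cdot\colon\mathbb R_{\ge0}\times\mathbf U\to\mathbf U$ is continuous, and thus it is the unique continuous extension of $\cdot\colon\mathbb D\times U_{\mathbb D}\to U_{\mathbb D}$, for any $\mathbb D\subseteq\mathbb R_{\ge0}$ which contains $0$ and $1$ and is closed under addition, multiplication, $(x,y)\mapsto|x-y|$ and $x\mapsto x/2$. Moreover, it satisfies the conditions needed to make $\mathbf U$ into a module over $\mathbb R_{\ge0}$: for all $x,y\in\mathbf U$ and $\lambda,\mu\in\mathbb R_{\ge0}$, $$\mu\cdot(\lambda\cdot x)=(\lambda\mu)\cdot x,\quad \lambda\cdot(x\leftrightarrow y)=(\lambda\cdot x)\leftrightarrow(\lambda\cdot y),\quad 1\cdot x=x,\quad 0\cdot x=[{}_0()].$$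
   Context: Construction (for $\mathbb D$ as in the claim, including $\mathbb D=\mathbb R_{\ge0}$). $A^*$ is the set of finite sequences in $A$, $::$ is concatenation. Put $W_{-1}=\emptyset$ and for $n\in\mathbb N$: $A_n=(W_{n-1}\times\mathbb D)^*$, $W_n=W_{n-1}\sqcup A_n$; $W=\coprod_nA_n$. An element of $A_n$ is written $a={}_n(a_i,\alpha_i)_{i<l}$, with age $\mathrm{age}(a)=n$, length $\mathrm{lnth}(a)=l$, predecessors $a_i\in W_{n-1}$ and $\alpha_i\in\mathbb D$ (the same list at different ages gives different elements); ${}_0()$ is the empty tuple of age $0$. For $a=(a_i,\alpha_i)_i$, $b=(b_j,\beta_j)_j$ in $W$ and $\lambda\in\mathbb D$ define recursively $$d(a,b)=\sup\big(\{|d(a_i,b)-\alpha_i| : i<\mathrm{lnth}(a)\}\cup\{|d(a,b_j)-\beta_j| : j<\mathrm{lnth}(b)\}\big),\qquad\sup\emptyset=0,$$ $$a\leftrightarrow b={}_{\mathrm{age}(a)+\mathrm{age}(b)}\big((a_i\leftrightarrow b,\alpha_i)_{i<\mathrm{lnth}(a)}\,{::}\,(a\leftrightarrow b_j,\beta_j)_{j<\mathrm{lnth}(b)}\big),\qquad \lambda\cdot a={}_{\mathrm{age}(a)}(\lambda\cdot a_i,\lambda\alpha_i)_{i<\mathrm{lnth}(a)}.$$ Put $V_{-1}=\emptyset$, $B_n=\{{}_n(a_i,\alpha_i)_{i<l}\in A_n : a_i\in V_{n-1},\ |d(a_i,a_j)-\alpha_i|\le\alpha_j\text{ for all }i,j<l\}$,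 $V_n=V_{n-1}\sqcup B_n$, $V=\coprod_nB_n\subseteq W$. On $V$ the map $d$ is a pseudometric; $U_{\mathbb D}=V/{\sim}$ with $a\sim b\iff d(a,b)=0$, and metric $d([a],[b])=d(a,b)$. The operations $\leftrightarrow$ and $\lambda\cdot$ restrict to $V$ and induce operations on $U_{\mathbb D}$. One has $U_{\mathbb D}\subseteq U_{\mathbb R_{\ge0}}$. $\mathbf U$ is the metric completion of $U_{\mathbb R_{\ge0}}$ (and each $U_{\mathbb D}$ is dense in it). On $\mathbf U$, $\leftrightarrow$ is the unique continuous extension of the operation $\leftrightarrow$ on $U_{\mathbb R_{\ge0}}$; for each $\lambda\in\mathbb R_{\ge0}$ the map $x\mapsto\lambda\cdot x$ on $\mathbf U$ is the unique continuous extension of the Lipschitz map $x\mapsto\lambda\cdot x$ on $U_{\mathbb R_{\ge0}}$. Products carry the product topology. *)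

(* Defs.v *)
From HB Require Import structures.
From mathcomp Require Import all_boot all_order all_algebra.
From mathcomp Require Import generic_quotient.
From mathcomp Require Import all_classical all_reals all_analysis.
From mathcomp Require Import lra zify.
Import Order.TTheory GRing.Theory Num.Theory.
Import numFieldTopology.Exports numFieldNormedType.Exports.

Set Implicit Arguments.
Unset Strict Implicit.
Unset Printing Implicit Defensive.

Local Open Scope classical_set_scope.
Local Open Scope ring_scope.

(* Conway-like construction of a Urysohn space with its operations. Notation of
   the source and names used here:
     a <-> b              join,  joinU  (on U_D),  joinUr  (on the completion)
     lambda . a           scale, scaleU (on U_D),  scaleUr (on the completion)
     U_D                  U D, a type of its own for each set of scalars D
     U_D <= U_{R >= 0}    inclU, the isometry [a] |-> [a]
     bold U               Urysohn_space R, which contains U (Rge0 R) by toUrysohn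
*)

(* [tree R] has a single constructor for all the sets A_n: [node n s] is the
   list s at age n. That the predecessors listed in s are younger than n and
   that the labels are scalars is imposed by [Vlt] below; [dist], [join] and
   [scale] make sense without it. *)
Inductive tree (R : Type) : Type := node of nat & seq (tree R * R).

HB.instance Definition _ (R : Type) := gen_eqMixin (tree R).
HB.instance Definition _ (R : Type) := gen_choiceMixin (tree R).

Definition age (R : Type) (a : tree R) : nat := let: node n _ := a in n.

Definition preds (R : Type) (a : tree R) : seq (tree R * R) :=
  let: node _ s := a in s.

Section Trees.
Variable R : realType.
Implicit Types (a b c : tree R) (p q : tree R * R).

(* The elements of the list are [>= 0], so that folding the maximum from 0
   computes the supremum, including for the empty list. *)
Fixpoint dist a : tree R -> R :=
  fix dist_a b :=
    foldr Num.max 0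
      ([seq `|dist p.1 b - p.2| | p <- preds a] ++
       [seq `|dist_a q.1 - q.2| | q <- preds b]).

Fixpoint join a : tree R -> tree R :=
  fix join_a b :=
    node (age a + age b)
      ([seq (join p.1 b, p.2) | p <- preds a] ++
       [seq (join_a q.1, q.2) | q <- preds b]).

Fixpoint scale (l : R) a : tree R :=
  node (age a) [seq (scale l p.1, l * p.2) | p <- preds a].

Definition zero_tree : tree R := node 0 [::].

(* [Blevel D n (Vlt D n)] is B_n and [Vlt D n] is V_(n-1), so that [Vlt D 0] is
   empty. *)
Definition Blevel (D : set R) (n : nat) (V : set (tree R)) : set (tree R) :=
  [set a | [/\ age a = n,
    forall p, p \in preds a -> V p.1,
    forall p, p \in preds a -> D p.2 &
    forall p q, p \in preds a -> q \in preds a ->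
      `|dist p.1 q.1 - p.2| <= q.2]].

Fixpoint Vlt (D : set R) (n : nat) : set (tree R) :=
  if n is m.+1 then Vlt D m `|` Blevel D m (Vlt D m) else set0.

Definition V (D : set R) : set (tree R) := \bigcup_n Vlt D n.

Fixpoint tsize a : nat := (sumn [seq tsize p.1 | p <- preds a]).+1.

Lemma tsize_preds a p : p \in preds a -> (tsize p.1 < tsize a)%N.
Proof.
case: a => n s /=; elim: s => //= q s IH; rewrite inE => /orP[/eqP ->|/IH]; lia.
Qed.

Lemma tree_ind_preds (P : tree R -> Prop) :
  (forall a, (forall p, p \in preds a -> P p.1) -> P a) -> forall a, P a.
Proof.
move=> H a; have [n] := ubnP (tsize a).
elim: n a => // n IH a an; apply: H => p pa; apply: IH.
by have := tsize_preds pa; lia.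
Qed.

Lemma foldr_max_le (s : seq R) e :
  0 <= e -> (forall x, x \in s -> x <= e) -> foldr Num.max 0 s <= e.
Proof.
move=> e0; elim: s => //= x s IH H; rewrite ge_max H ?mem_head//=.
by apply: IH => y ys; apply: H; rewrite inE ys orbT.
Qed.

Lemma le_foldr_max (s : seq R) x : x \in s -> x <= foldr Num.max 0 s.
Proof.
elim: s => //= y s IH; rewrite inE le_max => /orP[/eqP ->|/IH ->].
  by rewrite lexx.
by rewrite orbT.
Qed.

Lemma distE a b : dist a b = foldr Num.max 0
  ([seq `|dist p.1 b - p.2| | p <- preds a] ++
   [seq `|dist a q.1 - q.2| | q <- preds b]).
Proof. by case: a => n s; case: b. Qed.

Lemma dist_ge0 a b : 0 <= dist a b.
Proof. by rewrite distE; elim: (_ ++ _) => //= x s IH; rewrite le_max IH orbT. Qed.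

Lemma dist_le a b e : 0 <= e ->
  (forall p, p \in preds a -> `|dist p.1 b - p.2| <= e) ->
  (forall q, q \in preds b -> `|dist a q.1 - q.2| <= e) -> dist a b <= e.
Proof.
move=> e0 H1 H2; rewrite distE; apply: foldr_max_le => // x.
by rewrite mem_cat => /orP[]/mapP[p pp ->]; [exact: H1|exact: H2].
Qed.

Lemma le_distl a b p : p \in preds a -> `|dist p.1 b - p.2| <= dist a b.
Proof.
move=> pa; rewrite [leRHS]distE; apply: le_foldr_max; rewrite mem_cat.
by apply/orP; left; apply/mapP; exists p.
Qed.

Lemma le_distr a b q : q \in preds b -> `|dist a q.1 - q.2| <= dist a b.
Proof.
move=> qb; rewrite [leRHS]distE; apply: le_foldr_max; rewrite mem_cat.
by apply/orP; right; apply/mapP; exists q.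
Qed.

Lemma dist_sym a b : dist a b = dist b a.
Proof.
elim/tree_ind_preds: a b => a IHa; elim/tree_ind_preds => b IHb.
apply/eqP; rewrite eq_le; apply/andP; split.
  apply: dist_le => [|p pa|q qb]; first exact: dist_ge0.
    by rewrite IHa//; exact: le_distr.
  by rewrite IHb//; exact: le_distl.
apply: dist_le => [|p pa|q qb]; first exact: dist_ge0.
  by rewrite -IHb//; exact: le_distr.
by rewrite -IHa//; exact: le_distl.
Qed.

Lemma dist_triangle b a c : dist a c <= dist a b + dist b c.
Proof.
have [n] := ubnP (tsize a + tsize b + tsize c).
elim: n a b c => // n IH a b c abc.
apply: dist_le => [|p pa|q qc]; first by rewrite addr_ge0 ?dist_ge0.
  have pa' := tsize_preds pa.
  have := IH p.1 b c ltac:(lia); have := IH p.1 c b ltac:(lia).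
  by have := le_distl b pa; rewrite !ler_norml (dist_sym c b); lra.
have qc' := tsize_preds qc.
have := IH a b q.1 ltac:(lia); have := IH b a q.1 ltac:(lia).
by have := le_distr b qc; rewrite !ler_norml (dist_sym b a); lra.
Qed.

Lemma Vlt_age D n a : Vlt D n a -> (age a < n)%N.
Proof.
elim: n => // n IH /= [/IH|[-> _ _ _]]; [lia|exact: ltnSn].
Qed.

Lemma Vlt_le D m n a : (m <= n)%N -> Vlt D m a -> Vlt D n a.
Proof.
move=> /subnK <-; elim: (_ - _)%N => [//|k IH] /IH H; rewrite addSn; by left.
Qed.

Lemma Vlt_Blevel D n a : Vlt D n a -> Blevel D (age a) (Vlt D (age a)) a.
Proof. by elim: n => // n IH /= [/IH//|H]; have [-> _ _ _] := H. Qed.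

Lemma VP D a : V D a <-> [/\
  forall p, p \in preds a -> (age p.1 < age a)%N,
  forall p, p \in preds a -> V D p.1,
  forall p, p \in preds a -> D p.2 &
  forall p q, p \in preds a -> q \in preds a -> `|dist p.1 q.1 - p.2| <= q.2].
Proof.
split=> [[n _ /Vlt_Blevel[_ pV labels compat]]|[younger pV labels compat]].
  split=> // p /pV H; first exact: Vlt_age H.
  by exists (age a).
exists (age a).+1 => //; right; split=> // p pa.
have [n _ /Vlt_Blevel H] := pV p pa.
by apply: (Vlt_le (younger _ pa)); right.
Qed.

Lemma dist_le_preds D a p c :
  V D a -> p \in preds a -> dist a c <= p.2 + dist p.1 c.
Proof.
move=> /VP[_ _ _ compat] pa.
have p0 q : q \in preds a -> 0 <= q.2.
  by move=> qa; apply: le_trans (compat q q qa qa).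
elim/tree_ind_preds: c => c IH; apply: dist_le => [|q qa|q qc].
- by rewrite addr_ge0 ?dist_ge0 ?p0.
- have := compat _ _ pa qa; have := compat _ _ qa pa.
  have := dist_triangle p.1 q.1 c; have := dist_triangle c q.1 p.1.
  by rewrite (dist_sym p.1 q.1) (dist_sym c) !ler_norml; lra.
- have := IH _ qc; have := le_distl q.1 pa; have := le_distr p.1 qc.
  by rewrite !ler_norml; lra.
Qed.

Lemma dist_refl D a : V D a -> dist a a = 0.
Proof.
elim/tree_ind_preds: a => a IH aV.
have [_ pV _ _] := (VP _ _).1 aV.
have H p : p \in preds a -> dist a p.1 = p.2.
  move=> pa; have := dist_le_preds p.1 aV pa; rewrite (IH _ pa (pV _ pa)).
  have := le_distl p.1 pa; rewrite (IH _ pa (pV _ pa)) ler_norml; lra.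
apply/eqP; rewrite eq_le dist_ge0 andbT; apply: dist_le => // p pa.
  by rewrite dist_sym H// subrr normr0.
by rewrite H// subrr normr0.
Qed.

Lemma dist_preds D a p : V D a -> p \in preds a -> dist a p.1 = p.2.
Proof.
move=> aV pa; have [_ pV _ _] := (VP _ _).1 aV.
have := dist_le_preds p.1 aV pa; rewrite (dist_refl (pV _ pa)).
have := le_distl p.1 pa; rewrite (dist_refl (pV _ pa)) ler_norml; lra.
Qed.

Lemma V_sub (D E : set R) a : D `<=` E -> V D a -> V E a.
Proof.
move=> DE; elim/tree_ind_preds: a => a IH /VP[younger pV labels compat].
by apply/VP; split=> // p pa; [apply: IH => //; exact: pV|apply: DE; exact: labels].
Qed.

Lemma zero_tree_V D : V D zero_tree.
Proof. by apply/VP; split. Qed.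

Lemma preds_scale l a :
  preds (scale l a) = [seq (scale l p.1, l * p.2) | p <- preds a].
Proof. by case: a. Qed.

Lemma age_scale l a : age (scale l a) = age a.
Proof. by case: a. Qed.

Lemma dist_scale l a b : 0 <= l -> dist (scale l a) (scale l b) = l * dist a b.
Proof.
move=> l0; elim/tree_ind_preds: a b => a IHa; elim/tree_ind_preds => b IHb.
rewrite distE (distE a b) !preds_scale.
have -> (s : seq R) : l * foldr Num.max 0 s = foldr Num.max 0 [seq l * x | x <- s].
  by elim: s => [|x s IH] /=; rewrite ?mulr0// maxr_pMr// IH.
rewrite map_cat -!map_comp; congr (foldr _ _ (_ ++ _)).
  by apply/eq_in_map => p pa /=; rewrite IHa// -mulrBr normrM ger0_norm.
by apply/eq_in_map => p pa /=; rewrite IHb// -mulrBr normrM ger0_norm.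
Qed.

Lemma scale_V (D : set R) l a : 0 <= l -> (forall x, D x -> D (l * x)) ->
  V D a -> V D (scale l a).
Proof.
move=> l0 Dl; elim/tree_ind_preds: a => a IH /VP[younger pV labels compat].
apply/VP; split=> [p|p|p|p q]; rewrite preds_scale.
- by move=> /mapP[r ra ->] /=; rewrite !age_scale younger.
- by move=> /mapP[r ra ->] /=; apply: IH => //; exact: pV.
- by move=> /mapP[r ra ->] /=; apply/Dl/labels.
- move=> /mapP[r ra ->] /mapP[t ta ->] /=.
  by rewrite dist_scale// -mulrBr normrM ger0_norm// ler_wpM2l// compat.
Qed.

Lemma joinE a b : join a b = node (age a + age b)
  ([seq (join p.1 b, p.2) | p <- preds a] ++
   [seq (join a q.1, q.2) | q <- preds b]).
Proof. by case: a => n s; case: b. Qed.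

Lemma age_join a b : age (join a b) = (age a + age b)%N.
Proof. by rewrite joinE. Qed.

Lemma preds_joinP a b r : r \in preds (join a b) ->
  (exists2 p, p \in preds a & r = (join p.1 b, p.2)) \/
  (exists2 q, q \in preds b & r = (join a q.1, q.2)).
Proof.
by rewrite joinE /= mem_cat => /orP[]/mapP[p pp ->]; [left|right]; exists p.
Qed.

Lemma preds_joinl a b p : p \in preds a -> (join p.1 b, p.2) \in preds (join a b).
Proof. by move=> pa; rewrite (joinE a b) /= mem_cat (map_f (fun p => (join p.1 b, p.2))). Qed.

Lemma preds_joinr a b q : q \in preds b -> (join a q.1, q.2) \in preds (join a b).
Proof.
by move=> qb; rewrite (joinE a b) /= mem_cat orbC (map_f (fun q => (join a q.1, q.2))).
Qed.

Lemma dist_joinl_aux D n :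
  (forall a b, (tsize a + tsize b < n)%N -> V D a -> V D b ->
    V D (join a b)) ->
  forall b a c, V D a -> V D b -> V D c ->
  (tsize a + tsize b < n)%N -> (tsize c + tsize b < n)%N ->
  dist (join a b) (join c b) = dist a c.
Proof.
move=> JV b a c; have [m] := ubnP (tsize a + tsize c + tsize b).
elim: m a b c => // m IH a b c abc aV bV cV ab cb.
have [_ paV _ _] := (VP _ _).1 aV; have [_ pbV _ _] := (VP _ _).1 bV.
have [_ pcV _ _] := (VP _ _).1 cV.
have IHa p : p \in preds a -> dist (join p.1 b) (join c b) = dist p.1 c.
  by move=> pa; have := tsize_preds pa => ?; apply: IH => //; [lia|exact: paV|lia].
have IHc p : p \in preds c -> dist (join a b) (join p.1 b) = dist a p.1.
  by move=> pc; have := tsize_preds pc => ?; apply: IH => //; [lia|exact: pcV|lia].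
have IHb q : q \in preds b -> dist (join a q.1) (join c q.1) = dist a c.
  move=> qb; have := tsize_preds qb => ?.
  by apply: IH => //; [lia|exact: pbV|lia|lia].
have abV : V D (join a b) by exact: JV.
have cbV : V D (join c b) by exact: JV.
apply/eqP; rewrite eq_le; apply/andP; split.
  apply: dist_le => [|r /preds_joinP[]|r /preds_joinP[]]; first exact: dist_ge0.
  - by case=> p pa -> /=; rewrite IHa//; exact: le_distl.
  - case=> q qb -> /=; have := dist_preds cbV (preds_joinr c qb) => /= E.
    have := dist_triangle (join c q.1) (join a q.1) (join c b).
    have := dist_triangle (join a q.1) (join c q.1) (join c b).
    rewrite IHb// (dist_sym (join c q.1) (join c b)) E.
    by rewrite (dist_sym (join c q.1)) IHb// ler_norml; lra.
  - by case=> p pc -> /=; rewrite IHc//; exact: le_distr.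
  - case=> q qb -> /=; have := dist_preds abV (preds_joinr a qb) => /= E.
    have := dist_triangle (join a q.1) (join a b) (join c q.1).
    have := dist_triangle (join c q.1) (join a b) (join a q.1).
    rewrite IHb// E.
    by rewrite (dist_sym (join c q.1)) IHb// ler_norml; lra.
apply: dist_le => [|p pa|p pc]; first exact: dist_ge0.
  by rewrite -IHa//; exact: (le_distl _ (preds_joinl b pa)).
by rewrite -IHc//; exact: (le_distr _ (preds_joinl b pc)).
Qed.

Lemma dist_joinC_aux D n :
  (forall a b, (tsize a + tsize b < n)%N -> V D a -> V D b ->
    V D (join a b)) ->
  forall a b, V D a -> V D b -> (tsize a + tsize b < n)%N ->
  dist (join a b) (join b a) = 0.
Proof.
move=> JV; elim/tree_ind_preds => a IHa; elim/tree_ind_preds => b IHb.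
move=> aV bV ab.
have [_ paV _ _] := (VP _ _).1 aV; have [_ pbV _ _] := (VP _ _).1 bV.
have abV : V D (join a b) by exact: JV.
have baV : V D (join b a) by apply: JV => //; lia.
have Ea p : p \in preds a -> dist (join p.1 b) (join b p.1) = 0.
  move=> pa; have := tsize_preds pa => ?.
  by apply: IHa => //; [exact: paV|lia].
have Eb q : q \in preds b -> dist (join a q.1) (join q.1 a) = 0.
  move=> qb; have := tsize_preds qb => ?.
  by apply: IHb => //; [exact: pbV|lia].
have swap x y z : dist x y = 0 -> dist x z = dist y z.
  move=> xy; have := dist_triangle x y z; have := dist_triangle y x z.
  by rewrite (dist_sym y x) xy; lra.
apply/eqP; rewrite eq_le dist_ge0 andbT.
apply: dist_le => // r /preds_joinP[]; case=> p pp -> /=.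
- rewrite (swap _ _ _ (Ea _ pp)) dist_sym.
  by rewrite (dist_preds baV (preds_joinr b pp)) subrr normr0.
- rewrite (swap _ _ _ (Eb _ pp)) dist_sym.
  by rewrite (dist_preds baV (preds_joinl a pp)) subrr normr0.
- rewrite dist_sym -(swap _ _ _ (Eb _ pp)) dist_sym.
  by rewrite (dist_preds abV (preds_joinr a pp)) subrr normr0.
- rewrite dist_sym -(swap _ _ _ (Ea _ pp)) dist_sym.
  by rewrite (dist_preds abV (preds_joinl b pp)) subrr normr0.
Qed.

Lemma join_V D a b : V D a -> V D b -> V D (join a b).
Proof.
have [n] := ubnP (tsize a + tsize b).
elim: n a b => // n IH a b abn aV bV.
have [ya paV la ca] := (VP _ _).1 aV; have [yb pbV lb cb] := (VP _ _).1 bV.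
have JL := dist_joinl_aux IH; have JC := dist_joinC_aux IH.
have swap x y z : dist x y = 0 -> dist x z = dist y z.
  move=> xy; have := dist_triangle x y z; have := dist_triangle y x z.
  by rewrite (dist_sym y x) xy; lra.
have paJ p : p \in preds a -> V D (join p.1 b).
  by move=> pa; have := tsize_preds pa => ?; apply: IH => //; [lia|exact: paV].
have pbJ q : q \in preds b -> V D (join a q.1).
  by move=> qb; have := tsize_preds qb => ?; apply: IH => //; [lia|exact: pbV].
have cross p q : p \in preds a -> q \in preds b ->
    `|p.2 - q.2| <= dist (join p.1 b) (join a q.1) <= p.2 + q.2.
  move=> pa qb.
  have := dist_preds (paJ p pa) (preds_joinr p.1 qb) => /= E1.
  have := dist_preds (pbJ q qb) (preds_joinl q.1 pa) => /= E2.
  have := dist_triangle (join p.1 q.1) (join p.1 b) (join a q.1).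
  have := dist_triangle (join a q.1) (join p.1 b) (join p.1 q.1).
  have := dist_triangle (join p.1 b) (join a q.1) (join p.1 q.1).
  rewrite (dist_sym (join a q.1) (join p.1 b)).
  rewrite (dist_sym (join p.1 q.1) (join a q.1)) E1 E2.
  by rewrite ler_norml; lra.
have RI q r : q \in preds b -> r \in preds b ->
    dist (join a q.1) (join a r.1) = dist q.1 r.1.
  move=> qb rb; have := tsize_preds qb; have := tsize_preds rb => ? ?.
  have [qV rV] := (pbV _ qb, pbV _ rb).
  rewrite (swap _ _ _ (JC _ _ aV qV _)); last lia.
  rewrite dist_sym (swap _ _ _ (JC _ _ aV rV _)); last lia.
  by rewrite dist_sym JL//; lia.
apply/VP; split=> [r|r|r|r t].
- move=> /preds_joinP[]; case=> p pp -> /=; rewrite !age_join.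
    by have := ya _ pp; lia.
  by have := yb _ pp; lia.
- by move=> /preds_joinP[]; case=> p pp -> /=; [exact: paJ|exact: pbJ].
- by move=> /preds_joinP[]; case=> p pp -> /=; [exact: la|exact: lb].
- move=> /preds_joinP[] [p pp ->] /preds_joinP[] [q qq ->] /=.
  + have := tsize_preds pp; have := tsize_preds qq => ? ?.
    by rewrite JL//; [exact: ca|exact: paV|exact: paV|lia|lia].
  + by have := cross _ _ pp qq; rewrite !ler_norml; lra.
  + by have := cross _ _ qq pp; rewrite dist_sym !ler_norml; lra.
  + by rewrite RI//; exact: cb.
Qed.

Lemma dist_joinC D a b : V D a -> V D b -> dist (join a b) (join b a) = 0.
Proof.
move=> aV bV; apply: (@dist_joinC_aux D (tsize a + tsize b).+1) => // x y _.
exact: join_V.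
Qed.

Lemma dist_joinl D a b c : V D a -> V D b -> V D c ->
  dist (join a b) (join c b) = dist a c.
Proof.
move=> aV bV cV.
apply: (@dist_joinl_aux D (tsize a + tsize c + tsize b).+1) => //; try lia.
by move=> x y _; exact: join_V.
Qed.

Lemma dist_joinr D a b c : V D a -> V D b -> V D c ->
  dist (join a b) (join a c) = dist b c.
Proof.
move=> aV bV cV; rewrite -(dist_joinl bV aV cV).
have := dist_joinC aV bV; have := dist_joinC aV cV.
have := dist_triangle (join b a) (join a b) (join c a).
have := dist_triangle (join c a) (join a b) (join a c).
have := dist_triangle (join a b) (join b a) (join a c).
have := dist_triangle (join a c) (join b a) (join c a).
rewrite (dist_sym (join c a)) (dist_sym (join b a) (join a b)).
by rewrite (dist_sym (join b a) (join a c)); lra.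
Qed.

Lemma dist_join_le D a b a' b' : V D a -> V D b -> V D a' -> V D b' ->
  dist (join a b) (join a' b') <= dist a a' + dist b b'.
Proof.
move=> aV bV aV' bV'; rewrite -(dist_joinl aV bV aV') -(dist_joinr aV' bV bV').
exact: dist_triangle.
Qed.

End Trees.

(* The metric space obtained by identifying the points of a pseudometric space
   that are at distance 0. *)
Record pseudoDist (R : realType) := PseudoDist {
  pd_sort :> choiceType;
  pd : pd_sort -> pd_sort -> R;
  pdxx : forall x, pd x x = 0;
  pd_sym : forall x y, pd x y = pd y x;
  pd_triangle : forall y x z, pd x z <= pd x y + pd y z }.

Section MetricQuotient.
Variables (R : realType) (P : pseudoDist R).
Implicit Types x y z : P.

Lemma pd_ge0 x y : 0 <= pd x y.
Proof. by have := pd_triangle y x x; rewrite pdxx (pd_sym y); lra. Qed.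

Definition pd_equiv : rel P := fun x y => pd x y == 0.

Lemma pd_equiv_refl : reflexive pd_equiv.
Proof. by move=> x; rewrite /pd_equiv pdxx. Qed.

Lemma pd_equiv_sym : symmetric pd_equiv.
Proof. by move=> x y; rewrite /pd_equiv pd_sym. Qed.

Lemma pd_equiv_trans : transitive pd_equiv.
Proof.
move=> y x z /eqP xy /eqP yz; rewrite /pd_equiv eq_le pd_ge0 andbT.
by apply: le_trans (pd_triangle y x z) _; rewrite xy yz addr0.
Qed.

Canonical pd_equivRel := EquivRel pd_equiv pd_equiv_refl pd_equiv_sym pd_equiv_trans.

Definition metric_quot : Type := {eq_quot pd_equiv}%qT.
HB.instance Definition _ := Choice.on metric_quot.

Definition mclass (x : P) : metric_quot := (\pi_({eq_quot pd_equiv}%qT) x)%qT.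
Definition mrepr (u : metric_quot) : P := (repr (u : {eq_quot pd_equiv}%qT))%qT.

Lemma mreprK : cancel mrepr mclass.
Proof. by move=> u; exact: reprK. Qed.

Lemma eq_mclass x y : mclass x = mclass y <-> pd x y = 0.
Proof.
by split=> [/eqmodP/eqP//|xy]; apply/eqmodP; rewrite /= /pd_equiv xy.
Qed.

Lemma pd_mrepr x y : pd (mrepr (mclass x)) (mrepr (mclass y)) = pd x y.
Proof.
have E z : pd (mrepr (mclass z)) z = 0 by apply/eq_mclass; rewrite mreprK.
have := E x; have := E y.
set x' := mrepr (mclass x); set y' := mrepr (mclass y) => Ey Ex.
have := pd_triangle x' x y; have := pd_triangle x x' y'.
have := pd_triangle y' x' y; have := pd_triangle y x y'.
by rewrite (pd_sym x x') (pd_sym y y') Ex Ey; lra.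
Qed.

Let qdist (u v : metric_quot) : R := pd (mrepr u) (mrepr v).

Let qdistxx u : qdist u u = 0. Proof. exact: pdxx. Qed.

Let qdist_positivity u v : qdist u v = 0 -> u = v.
Proof. by move=> /eq_mclass; rewrite !mreprK. Qed.

Let qdist_sym u v : qdist u v = qdist v u. Proof. exact: pd_sym. Qed.

Let qdist_triangle v u w : qdist u w <= qdist u v + qdist v w.
Proof. exact: pd_triangle. Qed.

HB.instance Definition _ := isMetric.Build R metric_quot
  qdistxx qdist_positivity qdist_sym qdist_triangle.

Lemma mdist_mclass x y : mdist (mclass x) (mclass y) = pd x y.
Proof. exact: pd_mrepr. Qed.

Lemma mclassP (u : metric_quot) : exists x, u = mclass x.
Proof. by exists (mrepr u); rewrite mreprK. Qed.

End MetricQuotient.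

(* The completion by Cauchy sequences. *)
Section Completion.
Import metricType_numDomainType.
Variables (R : realType) (M : metricType R).

Definition cauchy_seqs : set (nat -> M) := [set x | cauchy (x @ \oo)].

Lemma cauchy_seqsP (x : nat -> M) : cauchy_seqs x <->
  forall e, 0 < e -> exists N, forall m n, (N <= m)%N -> (N <= n)%N ->
    mdist (x m) (x n) < e.
Proof.
rewrite /cauchy_seqs /= -(@cauchy_ballP R); split=> H e e0.
  have [[P Q] /= [[N1 _ HN1] [N2 _ HN2]] PQ] := H e e0.
  exists (maxn N1 N2) => m n; rewrite !geq_max => /andP[mN1 _] /andP[_ nN2].
  have := PQ (x m, x n); rewrite ballEmdist; apply.
  by split; [exact: HN1|exact: HN2].
have [N HN] := H e e0.
exists (x @` [set n | (N <= n)%N], x @` [set n | (N <= n)%N]) => /=.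
  by split; exists N => // n Nn; exists n.
move=> [_ _] [[m /= Nm <-] [n /= Nn <-]] /=.
by rewrite ballEmdist; exact: HN.
Qed.

Lemma cauchy_dist_cvg (x y : cauchy_seqs) :
  cvgn (fun n => mdist (\val x n) (\val y n)).
Proof.
have /cauchy_seqsP Hx := set_valP x; have /cauchy_seqsP Hy := set_valP y.
apply: cauchy_cvg; apply: cauchy_exP => e e0.
have e2 : 0 < e / 2 by lra.
have [N1 H1] := Hx _ e2; have [N2 H2] := Hy _ e2.
pose N := maxn N1 N2.
exists (mdist (\val x N) (\val y N)); exists N => // n /= Nn.
have [N1N N2N] : (N1 <= N)%N /\ (N2 <= N)%N by rewrite leq_maxl leq_maxr.
have := H1 N n N1N (leq_trans N1N Nn); have := H2 N n N2N (leq_trans N2N Nn).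
have := metric_triangle (\val x N) (\val x n) (\val y N).
have := metric_triangle (\val x n) (\val y n) (\val y N).
have := metric_triangle (\val x n) (\val x N) (\val y n).
have := metric_triangle (\val x N) (\val y N) (\val y n).
rewrite (metric_sym (\val x n) (\val x N)) (metric_sym (\val y n) (\val y N)).
rewrite /ball /= => *.
by rewrite ltr_norml; lra.
Qed.

Definition cauchy_dist (x y : cauchy_seqs) : R :=
  limn (fun n => mdist (\val x n) (\val y n)).

Lemma cauchy_distxx x : cauchy_dist x x = 0.
Proof.
rewrite /cauchy_dist (_ : (fun n => _) = fun=> 0) ?lim_cst//.
by apply/funext => n; rewrite mdistxx.
Qed.

Lemma cauchy_dist_sym x y : cauchy_dist x y = cauchy_dist y x.
Proof. rewrite /cauchy_dist; under eq_fun do rewrite metric_sym; by []. Qed.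

Lemma cauchy_dist_triangle y x z :
  cauchy_dist x z <= cauchy_dist x y + cauchy_dist y z.
Proof.
rewrite /cauchy_dist -limD; [|exact: cauchy_dist_cvg..].
apply: ler_lim; [exact: cauchy_dist_cvg|apply: is_cvgD; exact: cauchy_dist_cvg|].
by apply: nearW => n; exact: metric_triangle.
Qed.

Definition cauchy_pseudoDist : pseudoDist R :=
  PseudoDist cauchy_distxx cauchy_dist_sym cauchy_dist_triangle.

Definition completion := metric_quot cauchy_pseudoDist.
HB.instance Definition _ := Metric.on completion.

Lemma cst_cauchy (m : M) : cauchy_seqs (fun=> m).
Proof. by apply/cauchy_seqsP => e e0; exists 0%N => *; rewrite mdistxx. Qed.

Definition embed (m : M) : completion :=
  mclass (SigSub (mem_set (cst_cauchy m)) : cauchy_pseudoDist).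

Lemma embed_isometry m n : mdist (embed m) (embed n) = mdist m n.
Proof. by rewrite [LHS]mdist_mclass /= /cauchy_dist /= lim_cst. Qed.

Lemma cauchy_seq_near (x : cauchy_pseudoDist) (e : R) : 0 < e ->
  exists N, forall n, (N <= n)%N -> mdist (mclass x) (embed (\val x n)) <= e.
Proof.
move=> e0; have /cauchy_seqsP/(_ e e0)[N HN] := set_valP x.
exists N => n Nn; rewrite [leLHS]mdist_mclass; apply: limr_le.
  exact: cauchy_dist_cvg.
by exists N => // k /= Nk; apply/ltW/HN.
Qed.

Lemma embed_dense (u : completion) (e : R) : 0 < e -> exists m, mdist u (embed m) < e.
Proof.
move=> e0; have [x ->] := mclassP u.
have [|N HN] := cauchy_seq_near x (_ : 0 < e / 2); first lra.
by exists (\val x N); apply: le_lt_trans (HN N (leqnn N)) _; lra.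
Qed.

Lemma completion_complete (F : set_system completion) :
  ProperFilter F -> cauchy F -> exists u : completion, F --> u.
Proof.
move=> FF /cauchyP Fc.
have small (e : R) : 0 < e -> exists m, F (ball (embed m) e).
  move=> e0; have e2 : 0 < e / 2 by lra.
  have [u Fu] := Fc _ e2; have [m um] := embed_dense u e2; exists m.
  apply: filterS Fu => v; rewrite !ballEmdist /= => uv.
  by have := metric_triangle (embed m) u v; rewrite (metric_sym _ u); lra.
pose r n : R := n.+1%:R^-1.
have r0 n : 0 < r n by rewrite invr_gt0.
have [x Fx] := choice (fun n => small _ (r0 n)).
have near_r e : 0 < e -> exists N, forall n, (N <= n)%N -> r n < e.
  by move=> e0; have [N _ HN] := near_infty_natSinv_lt (PosNum e0); exists N.
have xC : cauchy_seqs x.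
  apply/cauchy_seqsP => e e0.
  have [|N HN] := near_r (e / 2); first lra.
  exists N => m n Nm Nn.
  have [v []] := filter_ex (filterI (Fx m) (Fx n)).
  rewrite !ballEmdist /= => mv nv; rewrite -embed_isometry.
  have := metric_triangle (embed (x m)) v (embed (x n)).
  by rewrite (metric_sym v); have := HN _ Nm; have := HN _ Nn; lra.
pose X : cauchy_pseudoDist := SigSub (mem_set xC).
exists (mclass X); apply/fcvgrPdist_lt => e e0.
have e2 : 0 < e / 2 by lra.
have [N1 H1] := cauchy_seq_near X e2; have [N2 H2] := near_r _ e2.
pose N := maxn N1 N2.
apply: filterS (Fx N) => v; rewrite ballEmdist /= => Nv.
have := metric_triangle (mclass X) (embed (x N)) v.
have := H1 N (leq_maxl _ _); have := H2 N (leq_maxr _ _); rewrite /=; lra.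
Qed.

End Completion.

Definition continuous_extension (A : Type) (X Y : topologicalType)
    (j : A -> X) (g : A -> Y) : set (X -> Y) :=
  [set h | continuous h /\ forall a, h (j a) = g a].

Section Extension.
Import metricType_numDomainType.
Variables (R : realType) (A : Type) (X : pseudoMetricType R) (M : metricType R).
Variables (j : A -> X) (g : A -> completion M).
Hypothesis j_dense : forall x e, 0 < e -> exists a, ball x e (j a).
Hypothesis g_unif : forall e, 0 < e -> exists2 d, 0 < d &
  forall a b, ball (j a) d (j b) -> mdist (g a) (g b) < e.

Lemma continuous_extension_unique (h k : X -> completion M) :
  continuous_extension j g h -> continuous_extension j g k -> h = k.
Proof.
move=> [hc hj] [kc kj]; apply/funext => x; apply: mdist_positivity.
apply/eqP; rewrite eq_le mdist_ge0 andbT; apply/ler_addgt0Pl => e e0.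
have e2 : 0 < e / 2 by lra.
have /cvgrPdist_lt/(_ _ e2) Hh := hc x.
have /cvgrPdist_lt/(_ _ e2) Hk := kc x.
have [d d0 Hd] := (nbhs_ballP _ _).1 (filterI Hh Hk).
have [a xa] := j_dense x d0; have := Hd _ xa.
rewrite /= hj kj => -[xg kg].
have := metric_triangle (h x) (g a) (k x); rewrite (metric_sym (g a)); lra.
Qed.

Lemma continuous_extension_exists : exists h, continuous_extension j g h.
Proof.
pose F x := filter_from [set e : R | 0 < e] (fun e => g @` [set a | ball x e (j a)]).
have FP x : ProperFilter (F x).
  apply: filter_from_proper; last first.
    by move=> e /= e0; have [a xa] := j_dense x e0; exists (g a), a.
  apply: filter_from_filter; first by exists 1 => /=.
  move=> d e /= d0 e0; exists (Num.min d e); first by rewrite lt_min d0.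
  move=> _ [a /= xa <-]; split; exists a => //=; apply: le_ball xa.
    by rewrite ge_min lexx.
  by rewrite ge_min lexx orbT.
have Fball e : 0 < e -> exists2 d, 0 < d & forall x a, ball x d (j a) ->
    F x (ball (g a) e).
  move=> e0; have [d d0 Hd] := g_unif e0.
  have d2 : 0 < d / 2 by lra.
  exists (d / 2) => // x a xa; exists (d / 2) => // _ [b /= xb <-].
  by rewrite ballEmdist; apply: Hd; exact: ball_splitr xa xb.
have Fcvg x : exists u : completion M, F x --> u.
  apply: completion_complete; apply/cauchy_exP => e e0.
  have [d d0 Hd] := Fball e e0; have [a xa] := j_dense x d0.
  by exists (g a); exact: Hd.
have [h Hh] := choice Fcvg.
have near_h e : 0 < e -> exists2 d, 0 < d & forall x a, ball x d (j a) ->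
    mdist (h x) (g a) < e.
  move=> e0; have e2 : 0 < e / 2 by lra.
  have [d d0 Hd] := Fball _ e2; exists d => // x a xa.
  have /fcvgrPdist_lt/(_ _ e2) Hx := Hh x.
  have [v []] := filter_ex (filterI (Hd _ _ xa) Hx).
  rewrite ballEmdist /= => av xv.
  by have := metric_triangle (h x) v (g a); rewrite (metric_sym v); lra.
exists h; split=> [x|a].
  apply/cvgrPdist_lt => e e0; have e2 : 0 < e / 2 by lra.
  have [d d0 Hd] := near_h _ e2; have d2 : 0 < d / 2 by lra.
  apply/nbhs_ballP; exists (d / 2) => //= y xy.
  have [a ya] := j_dense y d2.
  have := Hd x a (ball_split xy ya).
  have := Hd y a (le_ball _ ya) => /(_ ltac:(lra)).
  by have := metric_triangle (h x) (g a) (h y); rewrite (metric_sym (g a)); lra.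
apply: mdist_positivity; apply/eqP; rewrite eq_le mdist_ge0 andbT.
apply/ler_addgt0Pl => e e0; have [d d0 Hd] := near_h _ e0.
by rewrite addr0 ltW// Hd//; exact: ballxx.
Qed.

Lemma continuous_extensionP : exists h, unique (continuous_extension j g) h.
Proof.
have [h Hh] := continuous_extension_exists; exists h; split=> // k.
exact: continuous_extension_unique.
Qed.

End Extension.

Record scalars (R : realType) := Scalars {
  scalar_set :> set R;
  scalar_ge0 : forall x, scalar_set x -> 0 <= x;
  scalar0 : scalar_set 0;
  scalar1 : scalar_set 1;
  scalarD : forall x y, scalar_set x -> scalar_set y -> scalar_set (x + y);
  scalarM : forall x y, scalar_set x -> scalar_set y -> scalar_set (x * y);
  scalar_dist : forall x y, scalar_set x -> scalar_set y -> scalar_set `|x - y|;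
  scalar_half : forall x, scalar_set x -> scalar_set (x / 2) }.

Definition Rge0 (R : realType) : scalars R :=
  @Scalars R [set x | 0 <= x] (fun x x0 => x0) (lexx 0) ler01
    (fun x y x0 y0 => addr_ge0 x0 y0) (fun x y x0 y0 => mulr_ge0 x0 y0)
    (fun x y _ _ => normr_ge0 (x - y)) (fun x x0 => divr_ge0 x0 (ler0n R 2)).

Section ScalarOperations.
Variables (R : realType) (D : scalars R).

Definition szero : D := SigSub (mem_set (scalar0 D)).
Definition sone : D := SigSub (mem_set (scalar1 D)).
Definition smul (l m : D) : D :=
  SigSub (mem_set (scalarM (set_valP l) (set_valP m))).
Definition sincl (l : D) : Rge0 R :=
  SigSub (mem_set (scalar_ge0 (set_valP l) : scalar_set (Rge0 R) (\val l))).

Lemma sval_ge0 (l : D) : 0 <= \val l.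
Proof. exact: scalar_ge0 (set_valP l). Qed.

End ScalarOperations.

Section Uspace.
Variables (R : realType) (D : scalars R).

Definition distV (a b : V D) : R := dist (\val a) (\val b).

Lemma distVxx a : distV a a = 0.
Proof. exact: dist_refl (set_valP a). Qed.

Lemma distV_sym a b : distV a b = distV b a.
Proof. exact: dist_sym. Qed.

Lemma distV_triangle b a c : distV a c <= distV a b + distV b c.
Proof. exact: dist_triangle. Qed.

Definition V_pseudoDist : pseudoDist R :=
  PseudoDist distVxx distV_sym distV_triangle.

Definition U : Type := metric_quot V_pseudoDist.
HB.instance Definition _ := Metric.on U.

Definition zeroV : V D := SigSub (mem_set (zero_tree_V D)).

Definition joinV (a b : V D) : V D :=
  SigSub (mem_set (join_V (set_valP a) (set_valP b))).

Definition scaleV (l : D) (a : V D) : V D :=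
  SigSub (mem_set (scale_V (sval_ge0 l)
    (fun x => scalarM (set_valP l)) (set_valP a))).

Definition inclV (a : V D) : V (Rge0 R) :=
  SigSub (mem_set (V_sub (@scalar_ge0 R D : D `<=` Rge0 R) (set_valP a))).

Definition classU (a : V D) : U := @mclass R V_pseudoDist a.
Definition reprU (u : U) : V D := @mrepr R V_pseudoDist u.

Lemma mdist_classU a b : mdist (classU a) (classU b) = dist (\val a) (\val b).
Proof. exact: mdist_mclass. Qed.

Lemma reprUK : cancel reprU classU.
Proof. exact: mreprK. Qed.

Lemma eq_classU a b : classU a = classU b <-> dist (\val a) (\val b) = 0.
Proof. exact: eq_mclass. Qed.

Lemma reprU_class a : dist (\val (reprU (classU a))) (\val a) = 0.
Proof. by apply/eq_classU; rewrite reprUK. Qed.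

Definition zeroU : U := classU zeroV.

Definition joinU (u v : U) : U := classU (joinV (reprU u) (reprU v)).

Definition scaleU (l : D) (u : U) : U := classU (scaleV l (reprU u)).

Lemma joinU_class a b : joinU (classU a) (classU b) = classU (joinV a b).
Proof.
apply/eq_classU; apply/eqP; rewrite eq_le dist_ge0 andbT.
apply: le_trans (dist_join_le (set_valP _) (set_valP _) (set_valP a) (set_valP b)) _.
by rewrite !reprU_class addr0.
Qed.

Lemma scaleU_class l a : scaleU l (classU a) = classU (scaleV l a).
Proof.
by apply/eq_classU; rewrite /= dist_scale ?sval_ge0// reprU_class mulr0.
Qed.

Lemma mdist_joinU u v u' v' :
  mdist (joinU u v) (joinU u' v') <= mdist u u' + mdist v v'.
Proof. by rewrite mdist_classU; apply: dist_join_le; exact: set_valP. Qed.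

Lemma mdist_scaleU l u v : mdist (scaleU l u) (scaleU l v) = \val l * mdist u v.
Proof. by rewrite mdist_classU dist_scale ?sval_ge0. Qed.

End Uspace.

Definition inclU (R : realType) (D : scalars R) (u : U D) : U (Rge0 R) :=
  classU (inclV (reprU u)).

Lemma inclU_class (R : realType) (D : scalars R) (a : V D) :
  inclU (classU a) = classU (inclV a).
Proof. by apply/eq_classU; exact: reprU_class. Qed.

Lemma inclU_isometry (R : realType) (D : scalars R) (u v : U D) :
  mdist (inclU u) (inclU v) = mdist u v.
Proof. by rewrite mdist_classU -[in RHS](reprUK u) -[in RHS](reprUK v) mdist_classU. Qed.

Section UrysohnSpace.
Variable R : realType.
Local Notation UR := (U (Rge0 R)).

Definition Urysohn_space : Type := completion UR.
HB.instance Definition _ := Metric.on Urysohn_space.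
HB.instance Definition _ := isPointed.Build Urysohn_space (embed (zeroU (Rge0 R))).

Let Urysohn_complete (F : set_system Urysohn_space) :
  ProperFilter F -> cauchy F -> cvg F.
Proof.
by move=> FF /completion_complete[u Fu]; apply/cvg_ex; exists u.
Qed.

HB.instance Definition _ := Uniform_isComplete.Build Urysohn_space Urysohn_complete.

Definition toUrysohn : UR -> Urysohn_space := @embed R UR.

Lemma join_extensionP : exists h : Urysohn_space * Urysohn_space -> Urysohn_space,
  unique (continuous_extension
    (fun p : UR * UR => (toUrysohn p.1, toUrysohn p.2))
    (fun p => toUrysohn (joinU p.1 p.2))) h.
Proof.
apply: (@continuous_extensionP R) => [[x y] e e0|e e0].
  have [u xu] := embed_dense x e0; have [v yv] := embed_dense y e0.
  by exists (u, v); split; rewrite /= ballEmdist.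
exists (e / 2) => [|[u v] [u' v']]; first lra.
case; rewrite /= !ballEmdist /= => uu' vv'.
rewrite embed_isometry; have := mdist_joinU u v u' v'.
by move: uu' vv'; rewrite !embed_isometry; lra.
Qed.

Definition joinUr (x y : Urysohn_space) : Urysohn_space := sval (cid join_extensionP) (x, y).

Lemma scale_extensionP (l : Rge0 R) : exists h : Urysohn_space -> Urysohn_space,
  unique (continuous_extension toUrysohn (fun u => toUrysohn (scaleU l u))) h.
Proof.
apply: (@continuous_extensionP R) => [x e e0|e e0].
  by have [u xu] := embed_dense x e0; exists u; rewrite ballEmdist.
have l1 : 0 < \val l + 1 := ltr_wpDl (sval_ge0 l) ltr01.
exists (e / (\val l + 1)) => [|u v]; first by rewrite divr_gt0.
rewrite ballEmdist /= !embed_isometry mdist_scaleU (ltr_pdivlMr _ _ l1).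
by have := mdist_ge0 u v; rewrite mulrDr mulr1 mulrC; lra.
Qed.

Definition scaleUr (l : Rge0 R) : Urysohn_space -> Urysohn_space :=
  sval (cid (scale_extensionP l)).

Lemma joinUrP : unique (continuous_extension
    (fun p : UR * UR => (toUrysohn p.1, toUrysohn p.2))
    (fun p => toUrysohn (joinU p.1 p.2)))
  (fun p : Urysohn_space * Urysohn_space => joinUr p.1 p.2).
Proof.
rewrite (_ : (fun p => _) = sval (cid join_extensionP)); first exact: svalP.
by apply/funext => -[].
Qed.

Lemma scaleUrP (l : Rge0 R) :
  unique (continuous_extension toUrysohn (fun u => toUrysohn (scaleU l u)))
    (scaleUr l).
Proof. exact: svalP. Qed.

End UrysohnSpace.

(* Main.v *)
Require Import Defs.
From mathcomp Require Import all_boot all_order all_algebra.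
From mathcomp Require Import all_classical all_reals all_analysis.
From mathcomp Require Import ring lra.
Import Order.TTheory GRing.Theory Num.Theory.
Import numFieldTopology.Exports numFieldNormedType.Exports.
Import metricType_numDomainType.

Set Implicit Arguments.
Unset Strict Implicit.
Unset Printing Implicit Defensive.

Local Open Scope classical_set_scope.
Local Open Scope ring_scope.

(** The key point is that [scaleUr] is jointly continuous; everything else is
    then obtained by comparing continuous functions on dense sets.

    For fixed [l], [x |-> l . x] multiplies distances by [l] on U, and this
    passes to the completion as an inequality ([mdist_scaleUr]). For a fixed
    tree [a], [l |-> l . a] is Lipschitz, with a constant [K] that depends on
    [a] ([scale_lipschitz]). This constant is not bounded over U, so it is used
    only at one point [u] of U near the given [x]: the path from [l . x] to
    [m . y] through [l . u] and [m . u] has length at most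
    [l d(x, u) + K |l - m| + m d(u, y)] ([mdist_scaleUr_scalars]), which is
    small when [u] is chosen close to [x] and then [m] close to [l] and [y]
    close to [x].

    For uniqueness of the extension from D * U_D, that set must be dense. The
    closure of D under addition and halving makes D dense in [0, oo[
    ([scalar_dense]), and [V_dense] approximates trees with real labels by
    trees with labels in D. Labels that are merely close to the given ones need
    not satisfy the conditions that define V; they are taken in D, slightly too
    large, and then replaced by the largest 1-Lipschitz function below them,
    which satisfies the conditions, has values in D and is still close to the
    given labels.

    The module identities hold for trees: the first three are equalities of
    trees, while [0 . a] is only at distance 0 from the empty tree. They pass
    to the completion by uniqueness of continuous extensions. *)

(** * Minima over lists and lengths of paths *)

Lemma min_attained (R : realDomainType) (I : eqType) (s : seq I) (F : I -> R) i :
  i \in s -> exists2 j, j \in s & forall k, k \in s -> F j <= F k.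
Proof.
elim: s i => // a s IH i _; case: s IH => [|b s] IH.
  by exists a => [|k]; rewrite inE// => /eqP ->.
have [j js jmin] := IH b (mem_head _ _).
have [ja|aj] := leP (F j) (F a).
  exists j; first by rewrite inE js orbT.
  by move=> k; rewrite inE => /orP[/eqP ->|/jmin].
exists a; first exact: mem_head.
move=> k; rewrite inE => /orP[/eqP ->//|/jmin].
exact/le_trans/ltW.
Qed.

Section MetricPaths.
Variables (R : realType) (M : metricType R).
Implicit Types (x y z w : M) (a b c : R).

Lemma mdist_path2 y x z a b :
  mdist x y <= a -> mdist y z <= b -> mdist x z <= a + b.
Proof. by move=> xy yz; apply: le_trans (metric_triangle x y z) (lerD xy yz). Qed.

Lemma mdist_path3 y z x w a b c :
  mdist x y <= a -> mdist y z <= b -> mdist z w <= c -> mdist x w <= a + b + c.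
Proof. by move=> xy yz zw; apply: mdist_path2 zw; exact: mdist_path2 yz. Qed.

End MetricPaths.

(** * Scaling trees *)

Section ScaleTrees.
Variable R : realType.
Implicit Types (a b : tree R) (l m : R).

Lemma tree_eq a b : age a = age b -> preds a = preds b -> a = b.
Proof. by case: a b => [n s] [k t] /= -> ->. Qed.

Lemma scale_scale m l a : scale m (scale l a) = scale (l * m) a.
Proof.
elim/tree_ind_preds: a => a IH; apply: tree_eq; first by rewrite !age_scale.
rewrite !preds_scale -map_comp; apply/eq_in_map => p pa /=.
by rewrite IH// mulrCA mulrA.
Qed.

Lemma scale1_tree a : scale 1 a = a.
Proof.
elim/tree_ind_preds: a => a IH; apply: tree_eq; first by rewrite age_scale.
rewrite preds_scale -[RHS]map_id; apply/eq_in_map => -[c x] pa /=.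
by rewrite (IH _ pa) mul1r.
Qed.

Lemma scale_join l a b : scale l (join a b) = join (scale l a) (scale l b).
Proof.
elim/tree_ind_preds: a b => a IHa; elim/tree_ind_preds => b IHb.
apply: tree_eq; first by rewrite age_scale !age_join !age_scale.
rewrite preds_scale !joinE /= !preds_scale map_cat -!map_comp.
congr (_ ++ _); apply/eq_in_map => p pp /=; first by rewrite IHa.
by rewrite IHb.
Qed.

(** [0 . a] has the shape of [a], so that it is in general not the empty tree;
    but the empty tree is 0 times itself, and multiplication by 0 contracts all
    distances to 0. *)
Lemma dist_scale0 a : dist (scale 0 a) (zero_tree R) = 0.
Proof.
by rewrite [X in dist _ X](_ : _ = scale 0 (zero_tree R))// dist_scale// mul0r.
Qed.

(** By induction on [a]. If [p] is in the list of [a], then [m p.2] is the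
    distance from [m . a] to [m . p.1], so that the term
    [|d(l . p.1, m . a) - l p.2|] of [d(l . a, m . a)] is at most
    [d(l . p.1, m . p.1) + p.2 |l - m|]: the constants [K p + p.2] do. *)
Lemma scale_lipschitz (a : tree R) : V (Rge0 R) a -> exists2 K : R, 0 <= K &
  forall l m, 0 <= l -> 0 <= m -> dist (scale l a) (scale m a) <= K * `|l - m|.
Proof.
elim/tree_ind_preds: a => a IH aV; have [_ pV label0 _] := (VP _ _).1 aV.
have Vs l c : 0 <= l -> V (Rge0 R) c -> V (Rge0 R) (scale l c).
  by move=> l0; apply: scale_V => // x x0; exact: mulr_ge0.
have /choice[K HK] (p : tree R * R) : exists K, p \in preds a -> 0 <= K /\
    forall l m, 0 <= l -> 0 <= m ->
      dist (scale l p.1) (scale m p.1) <= K * `|l - m|.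
  have [pa|] := boolP (p \in preds a); last by exists 0.
  by have [K K0 HK] := IH _ pa (pV _ pa); exists K.
pose K' := foldr Num.max 0 [seq K p + p.2 | p <- preds a].
have K'0 : 0 <= K' by rewrite /K'; elim: map => //= x s; rewrite le_max orbC => ->.
exists K' => //.
(* Both halves of the list that defines the distance reduce to this bound. *)
suff H l m p : 0 <= l -> 0 <= m -> p \in preds a ->
    `|dist (scale l p.1) (scale m a) - l * p.2| <= K' * `|l - m|.
  move=> l m l0 m0; apply: dist_le => [|q|q]; rewrite ?mulr_ge0// preds_scale.
    by case/mapP=> p pa -> /=; exact: H.
  by case/mapP=> p pa -> /=; rewrite dist_sym (distrC l); exact: H.
move=> l0 m0 pa; have [K0 /(_ l m l0 m0) Hp] := HK p pa.
have := @dist_preds _ _ _ (scale m p.1, m * p.2) (Vs _ _ m0 aV).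
rewrite preds_scale (map_f (fun p => (scale m p.1, m * p.2)))// => /(_ isT) /= E.
have p0 : 0 <= p.2 := label0 _ pa.
have KK : (K p + p.2) * `|l - m| <= K' * `|l - m|.
  by rewrite ler_wpM2r// le_foldr_max// (map_f (fun p => K p + p.2)).
have lm : `|m * p.2 - l * p.2| = p.2 * `|l - m|.
  by rewrite -mulrBl normrM (ger0_norm p0) mulrC distrC.
have := dist_triangle (scale m p.1) (scale l p.1) (scale m a).
have := dist_triangle (scale l p.1) (scale m p.1) (scale m a).
rewrite (dist_sym (scale m p.1) (scale m a)) E (dist_sym (scale m p.1)).
move: lm KK Hp; set r := p.2 * `|l - m|; rewrite mulrDl -/r => lm KK Hp.
have : `|m * p.2 - l * p.2| <= r by rewrite lm.
by rewrite !ler_norml; lra.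
Qed.

End ScaleTrees.

(** * Density of the trees with labels in D *)

Section DenseScalars.
Variables (R : realType) (D : scalars R).

(** D contains the multiples of [2^-k]; the point [y] is the first one above
    [x]. Approximation from above matters in [V_dense]. *)
Lemma scalar_dense (x e : R) : 0 <= x -> 0 < e ->
  exists2 y, scalar_set D y & x <= y <= x + e.
Proof.
move=> x0 e0.
have [k ke] : exists k, 2^-1 ^+ k < e :> R.
  have [k _ /(_ k (leqnn k))] := near_infty_natSinv_expn_lt (PosNum e0).
  by rewrite /= div1r -exprVn; exists k.
set y : R := 2^-1 ^+ k in ke.
have y0 : 0 < y by rewrite exprn_gt0.
have Dy : scalar_set D y.
  rewrite /y; elim: k {ke y0 y} => [|k IH]; first exact: scalar1.
  by rewrite exprSr; exact: scalar_half.
have Dn n : scalar_set D (y *+ n).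
  by elim: n => [|n IH]; [exact: scalar0|rewrite mulrS; exact: scalarD].
exists (y *+ (Num.truncn (x / y)).+1) => //.
have xy : 0 <= x / y by rewrite divr_ge0// ltW.
have /andP[] := truncn_itv xy.
rewrite ler_pdivlMr// ltr_pdivrMr// !mulr_natl mulrS; lra.
Qed.

Lemma dist_scalar (a b : tree R) : V D a -> V D b -> scalar_set D (dist a b).
Proof.
elim/tree_ind_preds: a b => a IHa; elim/tree_ind_preds => b IHb aV bV.
have [_ pa la _] := (VP _ _).1 aV; have [_ pb lb _] := (VP _ _).1 bV.
have Dmax (s : seq R) : (forall x, x \in s -> scalar_set D x) ->
    scalar_set D (foldr Num.max 0 s).
  elim: s => [_|x s IH Ds] /=; first exact: scalar0.
  have Dx := Ds x (mem_head _ _).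
  have Ds' : scalar_set D (foldr Num.max 0 s).
    by apply: IH => y ys; apply: Ds; rewrite inE ys orbT.
  by rewrite maxEle; case: ifP.
rewrite distE; apply: Dmax => x; rewrite mem_cat => /orP[]/mapP[p pp ->].
  by apply: scalar_dist; [apply: IHa => //; exact: pa|exact: la].
by apply: scalar_dist; [apply: IHb => //; exact: pb|exact: lb].
Qed.

(** A predecessor [p.1] of [a] is approximated by [f p], up to [d], and its label
    [p.2] by [g p] in D. For a list of labels, membership in V says that they
    are 1-Lipschitz and that two of them add up to at least the distance of
    their predecessors. Taking [g p >= p.2 + d] ensures the second condition for
    [f] and [g], but the first may fail. So the label of [f p] is
    [h p = min_q (g q + d(f p, f q))]: it is 1-Lipschitz, the second condition
    is preserved by the triangle inequality, and since the original labels are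
    1-Lipschitz, [h p] is within [2 d] of [p.2]. The minimum being attained, [h p]
    is the sum of two elements of D. *)
Lemma V_dense (a : tree R) (e : R) : 0 < e -> V (Rge0 R) a ->
  exists b, [/\ V D b, age b = age a & dist a b <= e].
Proof.
elim/tree_ind_preds: a e => a IH e e0 aV.
have [younger pV label0 compat] := (VP _ _).1 aV.
(* The distance from [a] is at most [d] for the predecessors plus [2 d] for
   the labels. *)
pose d := e / 3; have d0 : 0 < d by rewrite /d; lra.
have /choice[f Hf] (p : tree R * R) : exists b, p \in preds a ->
    [/\ V D b, age b = age p.1 & dist p.1 b <= d].
  have [pa|] := boolP (p \in preds a); last by exists (zero_tree R).
  by have [b Hb] := IH _ pa _ d0 (pV _ pa); exists b.
have /choice[g Hg] (p : tree R * R) : exists x, p \in preds a ->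
    scalar_set D x /\ p.2 + d <= x <= p.2 + 2 * d.
  have [pa|] := boolP (p \in preds a); last by exists 0.
  have p0 : 0 <= p.2 := label0 _ pa.
  have [|x Dx Hx] := scalar_dense (x := p.2 + d) _ d0; first lra.
  by exists x => _; split=> //; lra.
have /choice[i Hi] (p : tree R * R) : exists q, p \in preds a ->
    q \in preds a /\ forall r, r \in preds a ->
      g q + dist (f p) (f q) <= g r + dist (f p) (f r).
  have [pa|] := boolP (p \in preds a); last by exists p.
  by have [q ? ?] := min_attained (fun q => g q + dist (f p) (f q)) pa; exists q.
pose h p := g (i p) + dist (f p) (f (i p)).
have Dh p : p \in preds a -> scalar_set D (h p).
  move=> pa; have [qa _] := Hi _ pa; have [Dq _] := Hg _ qa.
  have [fpV _ _] := Hf _ pa; have [fqV _ _] := Hf _ qa.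
  by apply: scalarD => //; exact: dist_scalar.
have lip p q : p \in preds a -> q \in preds a ->
    `|dist p.1 q.1 - dist (f p) (f q)| <= 2 * d.
  move=> /Hf[_ _ pd] /Hf[_ _ qd].
  have := dist_triangle p.1 (f p) (f q); have := dist_triangle q.1 p.1 (f q).
  have := dist_triangle (f p) p.1 q.1; have := dist_triangle (f q) (f p) q.1.
  by rewrite (dist_sym (f p) p.1) (dist_sym (f q) q.1) ler_norml; lra.
have hg p : p \in preds a -> `|h p - p.2| <= 2 * d.
  move=> pa; have [qa /(_ _ pa)] := Hi _ pa; rewrite -/(h p).
  have [fpV _ _] := Hf _ pa; rewrite (dist_refl fpV).
  have [_ gp] := Hg _ pa; have [_ gq] := Hg _ qa.
  have := lip _ _ pa qa; have := compat _ _ pa qa.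
  by rewrite !ler_norml /h; lra.
pose b := node (age a) [seq (f p, h p) | p <- preds a].
have bV : V D b.
  apply/VP; split=> [r|r|r|r t] /mapP[p pa ->] /=.
  - by have [_ -> _] := Hf _ pa; exact: younger.
  - by have [] := Hf _ pa.
  - exact: Dh.
  - move=> /mapP[q qa ->] /=.
    have [pa' pmin] := Hi _ pa; have [qa' qmin] := Hi _ qa.
    have := pmin _ qa'; have := qmin _ pa'; rewrite -/(h p) -/(h q).
    have [_ gp] := Hg _ pa'; have [_ gq] := Hg _ qa'.
    have := lip _ _ pa' qa'; have := compat _ _ pa' qa'.
    have := dist_triangle (f q) (f p) (f (i q)).
    have := dist_triangle (f p) (f q) (f (i p)).
    have := dist_triangle (f (i p)) (f p) (f q).
    have := dist_triangle (f (i q)) (f (i p)) (f q).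
    rewrite (dist_sym (f q) (f p)) (dist_sym (f (i q)) (f q)).
    by rewrite !ler_norml /h; lra.
exists b; split=> //; apply: dist_le => [|p pa|r /mapP[p pa ->]]; first exact: ltW.
  have E : dist b (f p) = h p := dist_preds bV (map_f (fun p => (f p, h p)) pa).
  have [_ _ pd] := Hf _ pa; have := hg _ pa.
  have := dist_triangle (f p) p.1 b; have := dist_triangle p.1 (f p) b.
  rewrite (dist_sym (f p) b) E (dist_sym (f p) p.1).
  by rewrite !ler_norml; rewrite /d in pd *; lra.
have E := dist_preds aV pa.
have [_ _ pd] := Hf _ pa; have := hg _ pa.
have := dist_triangle p.1 a (f p); have := dist_triangle (f p) a p.1.
rewrite E (dist_sym (f p) p.1) /=.
by rewrite !ler_norml; rewrite /d in pd *; lra.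
Qed.

End DenseScalars.

(** * Density of U_D in the completion *)

Lemma mdist_ball (R : realType) (M : metricType R) (x y : M) (e : R) :
  mdist x y < e -> ball x e y.
Proof. by rewrite ballEmdist. Qed.

Section ToUrysohn.
Variable R : realType.
Implicit Types (x : Urysohn_space R) (u v : U (Rge0 R)) (e : R).

Lemma toUrysohn_isometry u v : mdist (toUrysohn u) (toUrysohn v) = mdist u v.
Proof. exact: embed_isometry. Qed.

Lemma toUrysohn_dense x e : 0 < e -> exists u, mdist x (toUrysohn u) < e.
Proof. exact: embed_dense. Qed.

Lemma inclU_dense (D : scalars R) u e : 0 < e ->
  exists v : U D, mdist u (inclU v) <= e.
Proof.
move=> e0; have [b [bV _ ub]] := V_dense D e0 (set_valP (reprU u)).
exists (classU (SigSub (mem_set bV))).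
by rewrite inclU_class -{1}(reprUK u) mdist_classU.
Qed.

Lemma toUrysohn_inclU_dense (D : scalars R) x e : 0 < e ->
  exists u : U D, mdist x (toUrysohn (inclU u)) < e.
Proof.
move=> e0; have e3 : 0 < e / 3 by lra.
have e32 : e / 3 + e / 3 < e by lra.
have [u xu] := toUrysohn_dense x e3; have [v uv] := inclU_dense D u e3.
exists v; rewrite -(toUrysohn_isometry u) in uv.
exact: le_lt_trans (mdist_path2 (ltW xu) uv) e32.
Qed.

End ToUrysohn.

(** * The identities on U_D *)

Lemma eq_classU_val (R : realType) (D : scalars R) (a b : V D) :
  \val a = \val b -> classU a = classU b.
Proof. by move=> ab; apply/eq_classU; rewrite ab (dist_refl (set_valP b)). Qed.

Section ScaleU.
Variables (R : realType) (D : scalars R).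
Implicit Types (l m : D) (u v : U D).

Lemma scaleU_scaleU m l u : scaleU m (scaleU l u) = scaleU (smul l m) u.
Proof.
by rewrite -(reprUK u) !scaleU_class; apply: eq_classU_val; exact: scale_scale.
Qed.

Lemma scaleU_joinU l u v : scaleU l (joinU u v) = joinU (scaleU l u) (scaleU l v).
Proof.
rewrite -(reprUK u) -(reprUK v) !(scaleU_class, joinU_class).
by apply: eq_classU_val; exact: scale_join.
Qed.

Lemma scaleU_sone u : scaleU (sone D) u = u.
Proof.
rewrite -[in LHS](reprUK u) -[RHS](reprUK u) scaleU_class.
by apply: eq_classU_val; exact: scale1_tree.
Qed.

Lemma scaleU_szero u : scaleU (szero D) u = zeroU D.
Proof. by rewrite -(reprUK u) scaleU_class; apply/eq_classU; exact: dist_scale0. Qed.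

Lemma inclU_scaleU l u : inclU (scaleU l u) = scaleU (sincl l) (inclU u).
Proof.
by rewrite -(reprUK u) !(scaleU_class, inclU_class); exact: eq_classU_val.
Qed.

End ScaleU.

(** * The completion *)

Section ScaleUrysohn.
Variable R : realType.
Local Notation Ur := (Urysohn_space R).
Implicit Types (l m : Rge0 R) (x y : Ur).

Lemma scaleUr_continuous l : continuous (scaleUr l).
Proof. by have [[]] := scaleUrP l. Qed.

Lemma scaleUr_toUrysohn l u : scaleUr l (toUrysohn u) = toUrysohn (scaleU l u).
Proof. by have [[_ ->]] := scaleUrP l. Qed.

(** Equality holds on U, where [x] and [y] are approximated by [u] and [v]; the
    continuity of [scaleUr l] carries it over. Dividing by [l + 1] instead of [l] in
    the tolerance [d] covers [l = 0]. *)
Lemma mdist_scaleUr l x y : mdist (scaleUr l x) (scaleUr l y) <= \val l * mdist x y.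
Proof.
apply/ler_addgt0Pr => e e0.
have l0 := sval_ge0 l; have l1 : 0 < 2 * (\val l + 1) by lra.
pose d := e / (2 * (\val l + 1)).
have d0 : 0 < d / 2 by rewrite !divr_gt0.
have ld : (\val l + 1) * d = e / 2 by rewrite /d; field; lra.
have budget (A : R) : \val l * (A + d) <= \val l * A + e / 2.
  by rewrite mulrDr lerD2l -ld ler_wpM2r//; lra.
have total (A : R) : e / 4 + (\val l * A + e / 2) + e / 4 <= \val l * A + e.
  lra.
have approx z : exists u, mdist z (toUrysohn u) < d / 2 /\
    mdist (scaleUr l z) (scaleUr l (toUrysohn u)) < e / 4.
  have /cvgrPdist_lt/(_ (e / 4)) := @scaleUr_continuous l z.
  move=> /(_ ltac:(lra))/nbhs_ballP[r /= r0 Hr].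
  have s0 : 0 < Num.min r (d / 2) by rewrite lt_min r0.
  have [sr sd] : Num.min r (d / 2) <= r /\ Num.min r (d / 2) <= d / 2.
    by rewrite !ge_min !lexx orbT.
  have [u zu] := toUrysohn_dense z s0.
  exists u; split; first exact: lt_le_trans zu sd.
  by apply: Hr; exact: mdist_ball (lt_le_trans zu sr).
have [u [xu lxu]] := approx x; have [v [yv lyv]] := approx y.
have uv : mdist u v <= mdist x y + d.
  rewrite -(toUrysohn_isometry u v) [in leRHS](splitr d) addrCA addrA.
  rewrite metric_sym in xu.
  apply: mdist_path3 (ltW xu) _ (ltW yv).
  exact: lexx.
have luv : mdist (scaleUr l (toUrysohn u)) (scaleUr l (toUrysohn v)) <=
    \val l * mdist x y + e / 2.
  rewrite !scaleUr_toUrysohn toUrysohn_isometry mdist_scaleU.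
  exact: le_trans (ler_wpM2l l0 uv) (budget _).
rewrite metric_sym in lyv.
exact: le_trans (mdist_path3 (ltW lxu) luv (ltW lyv)) (total _).
Qed.

(** The path from [l . x] through [l . u] and [m . u] to [m . y]; only its middle
    part changes the scalar, and there [u] is a point of U, where the constant
    of [scale_lipschitz] is available. *)
Lemma mdist_scaleUr_scalars (u : U (Rge0 R)) : exists2 K : R, 0 <= K &
  forall l m x y, mdist (scaleUr l x) (scaleUr m y) <=
    \val l * mdist x (toUrysohn u) +
    (K * `|\val l - \val m| + \val m * mdist (toUrysohn u) y).
Proof.
have [K K0 HK] := scale_lipschitz (set_valP (reprU u)); exists K => // l m x y.
apply: mdist_path2 (mdist_scaleUr l x _) (mdist_path2 _ (mdist_scaleUr m _ y)).
rewrite !scaleUr_toUrysohn toUrysohn_isometry mdist_classU.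
exact: HK (sval_ge0 l) (sval_ge0 m).
Qed.

Lemma scaleUr_jointly_continuous :
  continuous (fun p : Rge0 R * Ur => scaleUr p.1 p.2).
Proof.
move=> p; apply/cvgrPdist_lt => e e0.
have := sval_ge0 p.1; set l : R := \val p.1 => l0.
have l1 : 0 < l + 1 by lra.
pose d := e / (4 * (l + 1)).
have d0 : 0 < d by rewrite divr_gt0//; lra.
have ld : (l + 1) * d = e / 4 by rewrite /d; field; lra.
have [u xu] := toUrysohn_dense p.2 d0.
have [K K0 HK] := mdist_scaleUr_scalars u.
pose r := e / (4 * (K + 1)).
have r0 : 0 < r by rewrite divr_gt0//; lra.
have Kr : (K + 1) * r = e / 4 by rewrite /r; field; lra.
(* Here [m] is the other scalar, [t] its distance to [l], and [a] and [b] are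
   the distances of [u] to the two points. *)
have small (m t a b : R) : 0 <= m -> m <= l + 1 -> 0 <= t -> t <= r ->
    0 <= a -> a <= d -> 0 <= b -> b <= d + d -> l * a + (K * t + m * b) < e.
  move=> m0 ml t0 tr a0 ad b0 bd.
  have : l * a <= l * d by rewrite ler_wpM2l.
  have : K * t <= K * r by rewrite ler_wpM2l.
  have : m * b <= (l + 1) * (d + d) by rewrite ler_pM.
  lra.
pose s := Num.min (Num.min 1 r) d.
have s0 : 0 < s by rewrite !lt_min ltr01 r0.
have [s1 sr sd] : [/\ s <= 1, s <= r & s <= d] by rewrite !ge_min !lexx !orbT.
apply/(nbhs_ballP p); exists s => // q [lq xq].
have {}lq : `|l - \val q.1| < s by exact: lq.
have {}xq : mdist p.2 q.2 <= d.
  by move: xq; rewrite ballEmdist => xq; exact: le_trans (ltW xq) sd.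
rewrite metric_sym in xu.
have uq := mdist_path2 (ltW xu) xq.
rewrite metric_sym in xu.
have m1 : \val q.1 <= l + 1.
  by move: (lt_le_trans lq s1); clear; rewrite ltr_norml; lra.
apply: le_lt_trans (HK p.1 q.1 p.2 q.2) _.
exact: (small _ _ _ _ (sval_ge0 q.1) m1 (normr_ge0 _) (le_trans (ltW lq) sr)
  (mdist_ge0 _ _) (ltW xu) (mdist_ge0 _ _) uq).
Qed.

Lemma joinUr_toUrysohn u v :
  joinUr (toUrysohn u) (toUrysohn v) = toUrysohn (joinU u v) :> Ur.
Proof. by have [[_ /(_ (u, v))]] := joinUrP R. Qed.

Lemma scaleUr_scaleUr m l x : scaleUr m (scaleUr l x) = scaleUr (smul l m) x.
Proof.
have [_ /(_ (scaleUr m \o scaleUr l)) ->] := scaleUrP (smul l m); first by [].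
split=> [z|u] /=; last by rewrite !scaleUr_toUrysohn scaleU_scaleU.
by apply: continuous_comp; exact: scaleUr_continuous.
Qed.

Lemma scaleUr_sone x : scaleUr (sone (Rge0 R)) x = x.
Proof.
have [_ /(_ id) ->] := scaleUrP (sone (Rge0 R)); first by [].
by split=> [z|u]; [exact: cvg_id|rewrite scaleU_sone].
Qed.

Lemma scaleUr_szero x : scaleUr (szero (Rge0 R)) x = toUrysohn (zeroU (Rge0 R)).
Proof.
have [_ /(_ (fun=> toUrysohn (zeroU (Rge0 R)))) ->] := scaleUrP (szero (Rge0 R)).
  by [].
by split=> [z|u]; [exact: cst_continuous|rewrite scaleU_szero].
Qed.

(** Both sides are continuous in [(x, y)] and agree on pairs of points of U. *)
Lemma scaleUr_joinUr l x y :
  scaleUr l (joinUr x y) = joinUr (scaleUr l x) (scaleUr l y).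
Proof.
have [[joinc _] _] := joinUrP R.
pose j (p : U (Rge0 R) * U (Rge0 R)) := (toUrysohn p.1, toUrysohn p.2).
have j_dense z (e : R) : 0 < e -> exists p, ball z e (j p).
  move=> e0; case: z => z1 z2.
  have [u zu] := toUrysohn_dense z1 e0; have [v zv] := toUrysohn_dense z2 e0.
  by exists (u, v); split; [exact: mdist_ball zu|exact: mdist_ball zv].
pose g (p : U (Rge0 R) * U (Rge0 R)) := toUrysohn (scaleU l (joinU p.1 p.2)).
suff: (fun z : Ur * Ur => scaleUr l (joinUr z.1 z.2)) =
      (fun z => joinUr (scaleUr l z.1) (scaleUr l z.2)).
  by move=> /(congr1 (@^~ (x, y))).
apply: (continuous_extension_unique (g := g) j_dense); split=> [z|p].
- apply: (continuous_comp (f := fun z : Ur * Ur => joinUr z.1 z.2)).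
    exact: joinc.
  exact: scaleUr_continuous.
- by rewrite joinUr_toUrysohn scaleUr_toUrysohn.
- apply: (@continuous2_cvg _ Ur Ur Ur (nbhs z) _ (fun w => scaleUr l w.1)
      (fun w => scaleUr l w.2) (@joinUr R) (scaleUr l z.1) (scaleUr l z.2)).
  + exact: (joinc (scaleUr l z.1, scaleUr l z.2)).
  + apply: (cvg_comp (G := nbhs z.1) fst (scaleUr l)); first exact: cvg_fst.
    exact: scaleUr_continuous.
  + apply: (cvg_comp (G := nbhs z.2) snd (scaleUr l)); first exact: cvg_snd.
    exact: scaleUr_continuous.
- by rewrite !scaleUr_toUrysohn joinUr_toUrysohn -scaleU_joinU.
Qed.

Lemma scale_pairs_dense (D : scalars R) (z : Rge0 R * Ur) (e : R) : 0 < e ->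
  exists p : D * U D, ball z e (sincl p.1, toUrysohn (inclU p.2)).
Proof.
move=> e0; have e2 : 0 < e / 2 by lra.
have [y Dy zy] := scalar_dense D (sval_ge0 z.1) e2.
have {}zy : `|\val z.1 - y| < e by rewrite ltr_norml; lra.
have [u zu] := toUrysohn_inclU_dense D z.2 e0.
by exists (SigSub (mem_set Dy), u); split; [exact: zy|exact: (mdist_ball zu)].
Qed.

End ScaleUrysohn.

Theorem proposition7p13 (R : realType) :
  [/\ continuous (fun p : Rge0 R * Urysohn_space R => scaleUr p.1 p.2),
      (forall D : scalars R,
        unique
          (continuous_extension
            (fun p : D * U D => (sincl p.1, toUrysohn (inclU p.2)))
            (fun p : D * U D => toUrysohn (inclU (scaleU p.1 p.2))))
          (fun p : Rge0 R * Urysohn_space R => scaleUr p.1 p.2)) &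
      forall (x y : Urysohn_space R) (l m : Rge0 R),
        [/\ scaleUr m (scaleUr l x) = scaleUr (smul l m) x,
            scaleUr l (joinUr x y) = joinUr (scaleUr l x) (scaleUr l y),
            scaleUr (sone (Rge0 R)) x = x &
            scaleUr (szero (Rge0 R)) x = toUrysohn (zeroU (Rge0 R))]].
Proof.
split=> [|D|x y l m]; first exact: scaleUr_jointly_continuous.
  have ext : continuous_extension
      (fun p : D * U D => (sincl p.1, toUrysohn (inclU p.2)))
      (fun p => toUrysohn (inclU (scaleU p.1 p.2)))
      (fun p : Rge0 R * Urysohn_space R => scaleUr p.1 p.2).
    split=> [|[l u] /=]; first exact: scaleUr_jointly_continuous.
    by rewrite scaleUr_toUrysohn inclU_scaleU.
  split=> // h; apply: continuous_extension_unique ext.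
  exact: scale_pairs_dense.
split; [exact: scaleUr_scaleUr|exact: scaleUr_joinUr|exact: scaleUr_sone|
  exact: scaleUr_szero].
Qed.
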